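(* Let $n\geq 4$ be an integer with $n\equiv 2\pmod 4$. Then $\hat{C}(T_n)$ is a maximal triply even code.
   Context: A code of length $m$ is a linear subspace of $\mathbb{F}_2^m$. A code is triply even if every codeword has weight divisible by $8$; a triply even code is maximal if it is not contained in any larger triply even code of the same length. The triangular graph $T_n$ has as vertices the two-element subsets of an $n$-element set, two vertices $\alpha,\beta$ being adjacent whenever $|\alpha\cap\beta|=1$. $C(T_n)$ is the binary code of length $\frac{n(n-1)}{2}$ spanned by the rows of the adjacency matrix of $T_n$. Let $l=8\left\lceil\frac18\cdot\frac{n(n-1)}{2}\right\rceil$ and $l'=l-\frac{n(n-1)}{2}$. Then $\hat{C}(T_n)=\langle\mathbf 1_l\rangle+\{(c|\mathbf 0_{l'})\mid c\in C(T_n)\}\subset\mathbb{F}_2^l$, where $\mathbf 1_l$ is the all-ones vector of length $l$, $\mathbf 0_{l'}$ is the zero vector of length $l'$, and $(u|v)$ denotes concatenation. *)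

(* Defs.v *)
From HB Require Import structures.
From mathcomp Require Import all_boot all_order all_algebra.
From mathcomp Require Import zify.

Set Implicit Arguments.
Unset Strict Implicit.
Unset Printing Implicit Defensive.

Import GRing.Theory.
Local Open Scope ring_scope.

Definition wt m (v : 'rV['F_2]_m) : nat := #|[set i | v 0 i != 0]|.

Definition triply_even m (C : {vspace 'rV['F_2]_m}) : Prop :=
  forall v, v \in C -> (8 %| wt v)%N.

Definition maximal_triply_even m (C : {vspace 'rV['F_2]_m}) : Prop :=
  triply_even C /\
  (forall D : {vspace 'rV['F_2]_m}, triply_even D -> (C <= D)%VS -> D = C).

(* The vertices are numbered by [enum_val], so that the vectors of length      *)
(* [#|T|] have their coordinates indexed by the vertices of the graph.         *)
Definition adj_mx (T : finType) (e : rel T) : 'M['F_2]_#|T| :=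
  \matrix_(i, j) (e (enum_val i) (enum_val j))%:R.

Definition graph_code (T : finType) (e : rel T) : {vspace 'rV['F_2]_#|T|} :=
  <<[seq row i (adj_mx e) | i <- enum 'I_#|T|]>>%VS.

Definition tri_vertex (n : nat) : finType := {A : {set 'I_n} | #|A| == 2%N}.

Definition tri_adj n : rel (tri_vertex n) :=
  fun a b => #|val a :&: val b| == 1%N.

Definition tri_code n : {vspace 'rV['F_2]_#|tri_vertex n|} :=
  graph_code (@tri_adj n).

Lemma card_tri_vertex n : #|tri_vertex n| = ((n * (n - 1)) %/ 2)%N.
Proof.
rewrite card_sig subn1 divn2 -bin2 -[in RHS](card_ord n) -card_draws.
by apply: eq_card => A; rewrite !inE.
Qed.

(* [(N + 7) %/ 8] is the ceiling of N / 8. *)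
Definition hat_length (n : nat) : nat :=
  (8 * (((n * (n - 1)) %/ 2 + 7) %/ 8))%N.

Definition hat_pad (n : nat) : nat := (hat_length n - (n * (n - 1)) %/ 2)%N.

Lemma hat_lengthE n : (#|tri_vertex n| + hat_pad n)%N = hat_length n.
Proof. by rewrite card_tri_vertex /hat_pad /hat_length; lia. Qed.

Definition pad_zero m k (c : 'rV['F_2]_m) : 'rV['F_2]_(m + k) := row_mx c 0.

Lemma pad_zero_is_linear m k : linear (@pad_zero m k).
Proof.
by move=> a u v; rewrite /pad_zero scale_row_mx add_row_mx scaler0 addr0.
Qed.

HB.instance Definition _ m k :=
  GRing.isLinear.Build 'F_2 'rV['F_2]_m 'rV['F_2]_(m + k) *:%R (@pad_zero m k)
    (@pad_zero_is_linear m k).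

Definition pad_code m k (C : {vspace 'rV['F_2]_m}) :
    {vspace 'rV['F_2]_(m + k)} :=
  (linfun (@pad_zero m k) @: C)%VS.

Lemma mem_pad_code m k (C : {vspace 'rV['F_2]_m}) (v : 'rV['F_2]_(m + k)) :
  v \in pad_code k C <-> exists2 c, c \in C & v = row_mx c 0.
Proof.
split=> [/memv_imgP[c Cc ->]|[c Cc ->]]; first by exists c; rewrite ?lfunE.
by apply/memv_imgP; exists c; rewrite ?lfunE.
Qed.

(* The ambient length is [#|tri_vertex n| + hat_pad n], which is               *)
(* [hat_length n] by [hat_lengthE]; this form avoids casting concatenations.   *)
Definition hat_tri_code n : {vspace 'rV['F_2]_(#|tri_vertex n| + hat_pad n)} :=
  (<[const_mx 1]> + pad_code (hat_pad n) (tri_code n))%VS.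

(* Main.v *)
Require Import Defs.
From mathcomp Require Import all_boot all_order all_algebra.
From mathcomp Require Import zify ring.

(** Let [M] be the vertex-edge incidence matrix of the complete graph [K_n], so
    that coordinates of the code are edges of [K_n] and [a *m M] is the cut
    between the support of [a] and its complement.  Modulo 2 the adjacency
    matrix of the triangular graph is [M^T *m M], whence the triangular code
    consists of the cuts of the even subsets of vertices ([mem_tri_code_cut],
    [cut_mem_tri_code]).

    Triply even: a cut of an [s]-subset has [s * (n - s)] edges ([wt_cut]).  If
    [s] is even and [n] is 2 modulo 4, then [s] and [n - s] are even and one of
    them is divisible by 4.  Adding the all-ones word replaces a weight by its
    complement in the length, which is a multiple of 8.

    Maximal: in a triply even code, any three words have an even number of
    common nonzero coordinates ([triply_even_sum3]).  Let [v] be a word of a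
    triply even code containing the extended code, and [g] its part on the
    edges of [K_n].  Write [G x y] for the sum of [g] over the edges that
    contain both [x] and [y]: this is the value of [g] at the edge [xy] if
    [x != y], and the degree of [x] in [g] if [x = y].  Comparing [v] with the
    cuts of [{x, y}] and [{x, z}] gives
      [G x x + G x z + G y x + G y z = 0].
    For [y = z] this says that all degrees have the same parity [c], and the
    relation becomes [G y z = G x y + G x z + c].  Fixing [x], this shows that
    [g] is the sum of the cut of the set of all [y] with [G x y = 1] and of [c]
    times the all-ones word ([graph_cut_decomposition]); that set is even
    because [\sum_y G x y] counts each edge at [x] twice.  Subtracting a word of
    the extended code from [v] thus leaves a word supported on the padding; it
    has weight at most 7, hence vanishes. *)

Section TriangularCodes.

Set Implicit Arguments.
Unset Strict Implicit.
Unset Printing Implicit Defensive.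

Import GRing.Theory.
Local Open Scope ring_scope.

(** * Binary weights *)

Lemma F2_addxx (x : 'F_2) : x + x = 0.
Proof. by apply/eqP; case: x => [[|[|]]]. Qed.

Lemma F2_oppr (x : 'F_2) : - x = x.
Proof. by apply/eqP; rewrite eq_sym -addr_eq0 F2_addxx. Qed.

Lemma F2_nat_eq0 k : (k%:R == 0 :> 'F_2) = ~~ odd k.
Proof. by rewrite -(inj_eq val_inj) /= val_Fp_nat // modn2 eqb0. Qed.

Lemma F2_natE (x : 'F_2) : x = (x != 0)%:R.
Proof. by apply/eqP; case: x => [[|[|]]]. Qed.

Lemma wtE m (v : 'rV['F_2]_m) : wt v = (\sum_i (v 0%R i != 0%R))%N.
Proof. by rewrite /wt cardsE -sum1_card big_mkcond; apply: eq_bigr. Qed.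

Lemma wt_natr m (v : 'rV['F_2]_m) : (wt v)%:R = \sum_i v 0 i :> 'F_2.
Proof. by rewrite wtE natr_sum; apply: eq_bigr => i _; rewrite -F2_natE. Qed.

Lemma wt_row_mx m k (u : 'rV['F_2]_m) (w : 'rV['F_2]_k) :
  wt (row_mx u w) = (wt u + wt w)%N.
Proof.
rewrite !wtE big_split_ord /=; congr (_ + _)%N; apply: eq_bigr => i _.
  by rewrite row_mxEl.
by rewrite row_mxEr.
Qed.

Lemma wt0 m : wt (0 : 'rV['F_2]_m) = 0%N.
Proof. by rewrite wtE big1 // => i _; rewrite mxE eqxx. Qed.

Lemma wt_eq0 m (v : 'rV['F_2]_m) : wt v = 0%N -> v = 0.
Proof.
move=> /eqP; rewrite cards_eq0 => /eqP v0; apply/rowP => i; rewrite mxE.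
by apply/eqP/negPn; have /setP/(_ i) := v0; rewrite !inE => ->.
Qed.

Lemma leq_wt m (v : 'rV['F_2]_m) : (wt v <= m)%N.
Proof. by rewrite -[leqRHS]card_ord; apply: max_card. Qed.

Lemma wt_complement m (v : 'rV['F_2]_m) :
  (wt (const_mx 1 + v)%R + wt v = m)%N.
Proof.
rewrite !wtE -big_split /= -[RHS]card_ord -sum1_card; apply: eq_bigr => i _.
by rewrite !mxE; case: (v 0 i) => [[|[|]]].
Qed.

(** Inclusion-exclusion for three supports, with the pairwise intersections
    eliminated: this is the polarization of the weight. *)
Lemma wt_polarization m (u v w : 'rV['F_2]_m) :
  (4 * wt (\row_i (u 0%R i * v 0%R i * w 0%R i)%R)
     + (wt (u + v)%R + wt (u + w)%R + wt (v + w)%R)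
   = wt u + wt v + wt w + wt (u + v + w)%R)%N.
Proof.
rewrite !wtE big_distrr -!big_split /=; apply: eq_bigr => i _; rewrite !mxE.
by case: (u 0 i) => [[|[|]]] // ?; case: (v 0 i) => [[|[|]]] // ?;
   case: (w 0 i) => [[|[|]]].
Qed.

(** By polarization four times the size of the triple intersection is divisible
    by 8, so that this size is even. *)
Lemma triply_even_sum3 m (D : {vspace 'rV['F_2]_m}) (u v w : 'rV['F_2]_m) :
  triply_even D -> u \in D -> v \in D -> w \in D ->
  \sum_i u 0 i * v 0 i * w 0 i = 0.
Proof.
move=> teD uD vD wD; have := wt_polarization u v w.
have := teD _ uD; have := teD _ vD; have := teD _ wD.
have : (8 %| wt (u + v)%R)%N by exact/teD/memvD.
have : (8 %| wt (u + w)%R)%N by exact/teD/memvD.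
have : (8 %| wt (v + w)%R)%N by exact/teD/memvD.
have : (8 %| wt (u + v + w)%R)%N by apply: teD; rewrite !memvD.
set p := \row_i _ => *.
have -> : \sum_i u 0 i * v 0 i * w 0 i = (wt p)%:R.
  by rewrite wt_natr; apply: eq_bigr => i _; rewrite mxE.
by apply/eqP; rewrite F2_nat_eq0; lia.
Qed.

(** * The triangular code as a code of cuts *)

Definition incidence_mx n : 'M['F_2]_(n, #|tri_vertex n|) :=
  \matrix_(x < n, i < #|tri_vertex n|) (x \in val (enum_val i))%:R.

Lemma tri_edgeP n (i : 'I_#|tri_vertex n|) :
  exists x y, x != y /\ val (enum_val i) = [set x; y].
Proof.
have /cards2P[x [y [xy e]]] := valP (enum_val i).
by exists x, y; split.
Qed.

Lemma sum_incidence_col n (i : 'I_#|tri_vertex n|) :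
  \sum_x incidence_mx n x i = 0.
Proof.
under eq_bigr do rewrite mxE.
rewrite -natr_sum -big_mkcond sum1_card.
by rewrite (eqP (valP (enum_val i))); apply: (F2_addxx 1).
Qed.

(** Two edges share 0, 1 or 2 vertices, so that they are adjacent if and only
    if the number of common vertices is odd. *)
Lemma adj_mx_incidence n :
  adj_mx (@tri_adj n) = (incidence_mx n)^T *m incidence_mx n.
Proof.
apply/matrixP => i j; rewrite !mxE.
under eq_bigr do rewrite !mxE -natrM mulnb -in_setI.
rewrite -natr_sum -big_mkcond sum1_card /tri_adj.
have := subset_leq_card (subsetIl (val (enum_val i)) (val (enum_val j))).
rewrite (eqP (valP (enum_val i))).
by case: #|_ :&: _| => [|[|[|k]]] //= _; apply/eqP.
Qed.

(** Every row of the adjacency matrix is the cut of the two ends of an edge,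
    and the support of a vector of zero sum is even. *)
Lemma mem_tri_code_cut n (v : 'rV['F_2]_#|tri_vertex n|) :
  v \in tri_code n ->
  exists2 a : 'rV['F_2]_n, \sum_x a 0 x = 0 & v = a *m incidence_mx n.
Proof.
rewrite /tri_code /graph_code; set X := map _ _ => vX.
rewrite (coord_span (X := in_tuple X) vX).
apply: (big_ind (fun v : 'rV['F_2]_#|tri_vertex n| =>
  exists2 a : 'rV['F_2]_n, \sum_x a 0 x = 0 & v = a *m incidence_mx n)).
- exists 0; last by rewrite mul0mx.
  by rewrite big1 // => x _; rewrite mxE.
- move=> _ _ [a a0 ->] [b b0 ->]; exists (a + b); last by rewrite mulmxDl.
  by under eq_bigr do rewrite mxE; rewrite big_split /= a0 b0 addr0.
move=> k _; have /mapP[i _ Xk] := mem_nth 0 (ltn_ord k : (k < size X)%N).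
exists (coord (in_tuple X) k v *: row i (incidence_mx n)^T).
  under eq_bigr do rewrite 3!mxE.
  by rewrite -mulr_sumr sum_incidence_col mulr0.
by rewrite /= Xk adj_mx_incidence row_mul scalemxAl.
Qed.

(** An even set of vertices is the sum of the pairs formed by its elements and a
    base vertex; the cuts of these pairs are rows of the adjacency matrix. *)
Lemma cut_mem_tri_code n (a : 'rV['F_2]_n) :
  \sum_x a 0 x = 0 -> a *m incidence_mx n \in tri_code n.
Proof.
case: n a => [|n] a a0.
  rewrite [_ *m _](_ : _ = 0) ?mem0v //.
  by apply/rowP => i; rewrite !mxE big_ord0.
have -> : a = \sum_x a 0 x *: (delta_mx 0 x + delta_mx 0 0).
  under [RHS]eq_bigr do rewrite scalerDr.
  by rewrite big_split /= -scaler_suml a0 scale0r addr0 -row_sum_delta.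
rewrite mulmx_suml; apply: memv_suml => x _; rewrite -scalemxAl; apply: memvZ.
have [->|x0] := eqVneq x 0.
  by rewrite -[delta_mx 0 0]scale1r -scalerDl F2_addxx scale0r mul0mx mem0v.
have e2 : #|[set x; 0]| == 2%N by rewrite cards2 x0.
pose i := enum_rank (exist _ [set x; 0] e2 : tri_vertex n.+1).
have -> : (delta_mx 0 x + delta_mx 0 0) *m incidence_mx n.+1
          = row i (adj_mx (@tri_adj n.+1)).
  rewrite adj_mx_incidence row_mul; congr (_ *m _).
  apply/rowP => y; rewrite !mxE enum_rankK /= !inE.
  by have [->|] := eqVneq y x; rewrite /= ?(negPf x0) ?addr0 ?add0r.
by apply/memv_span/map_f; rewrite mem_enum.
Qed.

(** * Weights *)

Lemma incidence_mxE n (i : 'I_#|tri_vertex n|) y z (a : 'rV['F_2]_n) :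
  y != z -> val (enum_val i) = [set y; z] ->
  (a *m incidence_mx n) 0 i = a 0 y + a 0 z.
Proof.
move=> yz ei; rewrite mxE (bigD1 y) //= (bigD1 z) 1?eq_sym //= big1.
  by rewrite !mxE ei !inE !eqxx orbT !mulr1 addr0.
by move=> x /andP[xy xz]; rewrite mxE ei !inE (negPf xy) (negPf xz) mulr0.
Qed.

(** The edges of a cut correspond to the pairs of a vertex inside the set and a
    vertex outside of it. *)
Lemma wt_cut n (a : 'rV['F_2]_n) :
  wt (a *m incidence_mx n) = (wt a * (n - wt a))%N.
Proof.
rewrite /wt; set S := [set x | a 0 x != 0].
set P := [set i | _].
have pair_inj (p q : 'I_n * 'I_n) : p \in setX S (~: S) ->
    q \in setX S (~: S) -> [set p.1; p.2] = [set q.1; q.2] -> p = q.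
  case: p q => [x y] [x' y']; rewrite !in_setX !in_setC /=.
  move=> /andP[xS yS] /andP[x'S y'S] e.
  have := set21 x y; have := set22 x y; rewrite e !in_set2.
  case/orP=> /eqP ey; first by rewrite ey x'S in yS.
  by case/orP=> /eqP ex; [rewrite ex ey | rewrite -ex xS in y'S].
have edge_inj : injective (fun i : 'I_#|tri_vertex n| => val (enum_val i)).
  by move=> i j /val_inj/enum_val_inj.
rewrite -(card_imset _ edge_inj).
have -> : [set val (enum_val i) | i in P]
          = [set [set p.1; p.2] | p in setX S (~: S)].
  apply/setP => A; apply/imsetP/imsetP => [[i + ->]|[[x y] + ->]].
    have [x [y [xy ei]]] := tri_edgeP i; rewrite inE (incidence_mxE _ xy ei) ei.
    have [xS|xS] := boolP (x \in S); have [yS|yS] := boolP (y \in S) => aP.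
    - move: xS yS aP; rewrite !inE.
      by case: (a 0 x) (a 0 y) => [[|[|]]] // ? [[|[|]]].
    - by exists (x, y) => //; rewrite in_setX in_setC xS yS.
    - by exists (y, x); [rewrite in_setX in_setC xS yS | rewrite setUC].
    - move: xS yS aP; rewrite !inE.
      by case: (a 0 x) (a 0 y) => [[|[|]]] // ? [[|[|]]].
  rewrite in_setX in_setC /= => /andP[xS yS].
  have xy : x != y by apply: contraNneq yS => <-.
  have e2 : #|[set x; y]| == 2%N by rewrite cards2 xy.
  pose e : tri_vertex n := exist _ [set x; y] e2.
  exists (enum_rank e); last by rewrite enum_rankK.
  rewrite inE (incidence_mxE (y := x) (z := y)) ?enum_rankK //.
  move: xS yS; rewrite !inE negbK => + /eqP ->; by rewrite addr0.
by rewrite (card_in_imset pair_inj) cardsX [#|~: S|]cardsCs setCK card_ord.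
Qed.

(** * The extended code *)

Lemma mem_hat_tri_codeP n (v : 'rV['F_2]_(#|tri_vertex n| + hat_pad n)) :
  v \in hat_tri_code n <->
  exists c (a : 'rV['F_2]_n), \sum_x a 0 x = 0 /\
    v = c *: const_mx 1 + row_mx (a *m incidence_mx n) 0.
Proof.
split=> [/memv_addP[_ /vlineP[c ->] [_ /mem_pad_code[w wC ->] ->]]|].
  by have [a a0 ->] := mem_tri_code_cut wC; exists c, a.
move=> [c [a [a0 ->]]]; apply: memv_add; first by rewrite memvZ ?memv_line.
by apply/mem_pad_code; exists (a *m incidence_mx n); rewrite ?cut_mem_tri_code.
Qed.

Lemma triply_even_hat_tri_code n :
  n = 2 %[mod 4] -> triply_even (hat_tri_code n).
Proof.
move=> n2 v /mem_hat_tri_codeP[c [a [a0 ->]]].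
have a_even : ~~ odd (wt a) by rewrite -F2_nat_eq0 wt_natr a0.
have cut8 : (8 %| wt (row_mx (a *m incidence_mx n) (0 : 'rV_(hat_pad n))))%N.
  rewrite wt_row_mx wt0 addn0 wt_cut.
  (* With [wt a = 2t] and [n = 2h] the weight is [4t(h - t)]; as [h] is odd, *)
  (* one of [t] and [h - t] is even. *)
  have [-> nE] : wt a = (2 * (wt a)./2)%N /\ n = (2 * n./2)%N by lia.
  have ha : ((wt a)./2 <= n./2)%N by apply/half_leq/leq_wt.
  rewrite [X in (X - _)%N]nE -mulnBr mulnACA (dvdn_pmul2l (p := 4) (d := 2)) //.
  by rewrite dvdn2 oddM oddB // (_ : odd n./2) ?andbN //; lia.
have [c0|c1] := eqVneq c 0; first by rewrite c0 scale0r add0r.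
have -> : c = 1 by rewrite (F2_natE c) c1.
rewrite scale1r.
have := wt_complement (row_mx (a *m incidence_mx n) (0 : 'rV_(hat_pad n))).
by rewrite -(dvdn_addl _ cut8) => ->; rewrite hat_lengthE dvdn_mulr.
Qed.

(** * Words orthogonal to products of cuts *)

(** The hypothesis says that [g] meets the intersection of the cuts of [{x, y}]
    and [{x, z}] evenly.  Expanding the product turns it into a relation between
    adjacencies and degrees in [g], which determines [g] from its values at the
    edges through one vertex and from one degree. *)
Lemma graph_cut_decomposition n (g : 'rV['F_2]_#|tri_vertex n|) :
  let M := incidence_mx n in
  (forall x y z, \sum_i g 0 i * (M x i + M y i) * (M x i + M z i) = 0) ->
  exists c (a : 'rV['F_2]_n),
    \sum_x a 0 x = 0 /\ g = c *: const_mx 1 + a *m M.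
Proof.
move=> M gM; case: n => [|n] in g M gM *.
  exists 0, 0; split; first by rewrite big_ord0.
  apply/rowP => i; have [[]] // := tri_edgeP i.
(* For [x != y] only the edge [xy] contributes; [G x x] is the degree of [x]. *)
pose G x y := \sum_i g 0 i * M x i * M y i.
have G_sym x y : G x y = G y x by apply: eq_bigr => i _; ring.
have G_rel x y z : G x x + G x z + G y x + G y z = 0.
  by rewrite -[RHS](gM x y z) -!big_split; apply: eq_bigr => i _ /=; ring.
have G_deg x y : G x x = G y y.
  have := G_rel x y y; rewrite (G_sym y x) -(addrA (G x x)) F2_addxx addr0.
  by move/eqP; rewrite addr_eq0 F2_oppr => /eqP.
have G_edge i y z : y != z -> val (enum_val i) = [set y; z] -> G y z = g 0 i.
  move=> yz ei; rewrite /G (bigD1 i) //= big1 => [|j ji].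
    by rewrite !mxE ei !inE !eqxx orbT !mulr1 addr0.
  rewrite !mxE -mulrA -natrM mulnb [_ && _](_ : _ = false) ?mulr0 //.
  apply: contraNF ji => /andP[yj zj]; apply/eqP/enum_val_inj/val_inj.
  apply/esym/eqP; rewrite eqEcard ei subUset !sub1set yj zj.
  by rewrite (eqP (valP (enum_val j))) cards2 yz.
exists (G 0 0), (\row_x G 0 x); split.
  under eq_bigr do rewrite mxE.
  rewrite exchange_big big1 //= => i _.
  by rewrite -mulr_sumr sum_incidence_col mulr0.
apply/rowP => i; have [y [z [yz ei]]] := tri_edgeP i.
rewrite mxE (incidence_mxE _ yz ei) !mxE mulr1 -(G_edge i y z yz ei).
have /eqP := G_rel 0 y z; rewrite addr_eq0 F2_oppr => /eqP <-.
by rewrite (G_sym y 0); ring.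
Qed.

(** The padding is shorter than 8, so that it supports no nonzero word of weight
    divisible by 8. *)
Lemma triply_even_over_hat_tri_code n
    (D : {vspace 'rV['F_2]_(#|tri_vertex n| + hat_pad n)}) :
  triply_even D -> (hat_tri_code n <= D)%VS -> (D <= hat_tri_code n)%VS.
Proof.
move=> teD /subvP CD; apply/subvP => v vD.
pose M := incidence_mx n.
have [x y z|c [a [a0 gE]]] := @graph_cut_decomposition n (lsubmx v).
  pose cut w : 'rV_(_ + hat_pad n) :=
    row_mx ((delta_mx 0 x + delta_mx 0 w) *m M) 0.
  have cutD w : cut w \in D.
    apply/CD/mem_hat_tri_codeP; exists 0, (delta_mx 0 x + delta_mx 0 w).
    split; last by rewrite scale0r add0r.
    under eq_bigr do rewrite !mxE eqxx /=.
    have sum1 u : \sum_(k < n) (k == u)%:R = 1 :> 'F_2.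
      by rewrite (bigD1 u) //= eqxx big1 ?addr0 // => k /negPf ->.
    by rewrite big_split /= !sum1 F2_addxx.
  rewrite -[RHS](triply_even_sum3 teD vD (cutD y) (cutD z)) big_split_ord /=.
  rewrite [X in _ + X]big1 => [|i _]; last by rewrite !row_mxEr !mxE mulr0.
  rewrite addr0; apply: eq_bigr => i _.
  by rewrite !row_mxEl !mulmxDl -!rowE !mxE.
pose w := c *: const_mx 1 + row_mx (a *m M) 0 : 'rV_(_ + hat_pad n).
have wC : w \in hat_tri_code n by apply/mem_hat_tri_codeP; exists c, a.
have vwD : v - w \in D := memvB vD (CD _ wC).
have vwE : v - w = row_mx 0 (rsubmx (v - w)).
  rewrite -[LHS]hsubmxK; congr row_mx.
  by rewrite linearB linearD linearZ /= gE row_mxKl lsubmx_const subrr.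
have pad7 : (hat_pad n <= 7)%N by rewrite /hat_pad /hat_length; lia.
have : v - w = 0.
  apply: wt_eq0; move: (teD _ vwD) (leq_wt (rsubmx (v - w))) vwE.
  move: (rsubmx _) => p + + vwE; rewrite vwE wt_row_mx wt0 add0n.
  move=> wt8 /leq_trans/(_ pad7); move: wt8 {pad7}; move: (wt p) => k; lia.
by move/eqP; rewrite subr_eq0 => /eqP ->.
Qed.

End TriangularCodes.

Theorem theorem18 (n : nat) (hn : 4 <= n) (hmod : n = 2 %[mod 4]) :
  maximal_triply_even (hat_tri_code n).
Proof.
split=> [|D teD CD]; first exact: triply_even_hat_tri_code.
by apply/eqP; rewrite eqEsubv CD andbT; apply: triply_even_over_hat_tri_code.
Qed.
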